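(* Let $(\mathbb V,\mathbb E,\mathbf P,\mathcal W)$ be a weighted Markovian graph satisfying assumptions (A) and (A$^*$) (see context), and let $K_{\mathcal W}(\mathbf P,\mathcal W)=\sum_{i,j\in\mathbb V}\boldsymbol\pi_{\mathcal W}(i)\mathbf M(i,j)\boldsymbol\pi_{\mathcal W}(j)$. Then, with $\mathbf P$ held fixed, for $(l,k)\in\mathbb E$, $$\frac{\partial K_{\mathcal W}(\mathbf P,\mathcal W)}{\partial\mathbf W(l,k)}=\frac{\boldsymbol\pi(l)\mathbf P(l,k)}{Y^2}\Big[(Y\mathbf e_l-\mathbf n)^\top\mathbf M\boldsymbol\pi_{\mathcal W}^\top+\boldsymbol\pi_{\mathcal W}\mathbf M(Y\mathbf e_l-\mathbf n)\Big]+\boldsymbol\pi_{\mathcal W}\frac{\partial\mathbf M}{\partial\mathbf W(l,k)}\boldsymbol\pi_{\mathcal W}^\top,$$ where $\mathbf n=(\boldsymbol\pi(1)\bar U(1),\dots,\boldsymbol\pi(n)\bar U(n))^\top$, $Y=\sum_{i\in\mathbb V}\boldsymbol\pi(i)\bar U(i)$, and $$\frac{\partial\mathbf M}{\partial\mathbf W(l,k)}=\mathbf P(l,k)\Big[\mathbf Z\mathbf e_l\mathbf 1^\top-\mathbf 1\mathbf 1^\top[\mathbf Z\mathbf e_l\mathbf 1^\top]_{\mathrm{dg}}+\boldsymbol\pi(l)\big(\mathbf I-\mathbf Z+\mathbf 1\mathbf 1^\top[\mathbf Z]_{\mathrm{dg}}\big)\Xi^{-1}\Big].$$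
   Context: Weighted Markovian graph $(\mathbb V,\mathbb E,\mathbf P,\mathcal W)$: $\mathbb V=\{1,\dots,n\}$; $\mathbb E\subseteq\mathbb V\times\mathbb V$; the graph is strongly connected; $\mathbf P$ is a row-stochastic $n\times n$ matrix with $\mathbf P(i,j)\ge 0$ for $(i,j)\in\mathbb E$ and $\mathbf P(i,j)=0$ otherwise, assumed irreducible and (unless otherwise stated) aperiodic. The weights $\mathcal W(i,j)$ (random, or deterministic as a special case) take values in $[\epsilon,\infty)$ for $(i,j)\in\mathbb E$, for some $\epsilon>0$, and are zero otherwise. Assumption (A): $\mathbf P$ has a unique stationary distribution $\boldsymbol\pi$ (a row vector), and $\mathbf W(i,j)=\mathbb E[\mathcal W(i,j)]<\infty$, $\mathbf W^{(2)}(i,j)=\mathbb E[\mathcal W(i,j)^2]<\infty$ for $(i,j)\in\mathbb E$. Assumption (A$^*$): the weight matrices $(\mathcal W(i,j;m))_{i,j}$, $m\ge1$, used at successive transitions $m=1,2,\dots$ are i.i.d. (with the law of $\mathcal W$); they are independent of the chain. Let $(\hat X_k)_{k\ge0}$ be the Markov chain with transition matrix $\mathbf P$. For $\hat X_0=i$ let $\hat\tau(i,j)=\inf\{m\ge1:\hat X_m=j\}$ (first return time if $i=j$) and $\tau(i,j)=\sum_{m=1}^{\hat\tau(i,j)}\mathcal W(\hat X_{m-1},\hat X_m;m)$. Set $\mathbf M(i,j)=\mathbb E[\tau(i,j)]$. Let $\bar U(i)=\sum_{k\in\mathbb V}\mathbf P(i,k)\mathbf W(i,k)$ and let $\boldsymbol\pi_{\mathcal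 W}$ be the row vector with $\boldsymbol\pi_{\mathcal W}(i)=\boldsymbol\pi(i)\bar U(i)\big/\sum_{j\in\mathbb V}\boldsymbol\pi(j)\bar U(j)$. All of $\mathbf M$, $\boldsymbol\pi_{\mathcal W}$, $K_{\mathcal W}$ depend on the weights only through $\mathbf W$ and are regarded as functions of $\mathbf W$. Notation: $\mathbf 1$ is the all-ones column vector; $\mathbf e_l$ is the $l$-th standard basis column vector; $[\cdot]_{\mathrm{dg}}$ sets all off-diagonal entries of a matrix to zero; $\Xi=\mathrm{diag}(\boldsymbol\pi(1),\dots,\boldsymbol\pi(n))$; $\Pi=\mathbf 1\boldsymbol\pi$; $\mathbf Z=(\mathbf I-\mathbf P+\Pi)^{-1}$. *)

(* Defs.v *)
(* MathComp / MathComp-Analysis, over an arbitrary realType. *)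
From HB Require Import structures.
From mathcomp Require Import all_boot all_order all_algebra.
From mathcomp Require Import all_classical all_reals all_analysis.
Set Implicit Arguments.
Unset Strict Implicit.
Unset Printing Implicit Defensive.
Import Order.TTheory GRing.Theory Num.Theory.
Import numFieldNormedType.Exports.
Local Open Scope classical_set_scope.
Local Open Scope ring_scope.

Section MarkovianGraph.
Context (R : realType) (n : nat).
Implicit Types (E : rel 'I_n) (P : 'M[R]_n) (pi : 'rV[R]_n).

Definition strongly_connected E : Prop := forall i j, connect E i j.

Definition stochastic_on E P : Prop :=
  [/\ forall i j, E i j -> 0 <= P i j, forall i j, ~~ E i j -> P i j = 0 &
      forall i, \sum_j P i j = 1].

Definition irreducible P : Prop := forall i j, exists m, 0 < (P ^+ m) i j.

(* The gcd of the return times { m >= 1 | P^m(i,i) > 0 } is 1: the only common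
   divisor is 1. *)
Definition aperiodic P : Prop :=
  forall i d, (forall m, (0 < m)%N -> 0 < (P ^+ m) i i -> (d %| m)%N) -> d = 1%N.

Definition markovian_graph E P : Prop :=
  [/\ strongly_connected E, stochastic_on E P, irreducible P & aperiodic P].

Definition stationary P pi : Prop :=
  [/\ forall i, 0 <= pi 0 i, \sum_i pi 0 i = 1 & pi *m P = pi].

Definition unique_stationary P pi : Prop :=
  stationary P pi /\ forall pi', stationary P pi' -> pi' = pi.

Definition weights_on E (eps : R) (A : 'M[R]_n) : Prop :=
  (forall i j, E i j -> eps <= A i j) /\ (forall i j, ~~ E i j -> A i j = 0).

(* The domain on which quantities depending on the weights through their mean
   are regarded as functions of that mean. *)
Definition weight_domain E (A : 'M[R]_n) : Prop :=
  exists2 eps, 0 < eps & weights_on E eps A.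

End MarkovianGraph.

Section Independence.
Context (R : realType) (d : measure_display) (T : measurableType d).
Context (Pr : probability T R).

Definition independent_classes (F G : set_system T) : Prop :=
  forall A B, F A -> G B -> Pr (A `&` B) = (Pr A * Pr B)%E.

Definition mutually_independent (J : set nat) (F : nat -> set_system T) : Prop :=
  forall (s : seq nat) (A : nat -> set T), uniq s -> [set` s] `<=` J ->
    (forall m, m \in s -> F m (A m)) ->
    Pr (\bigcap_(m in [set` s]) A m) = (\prod_(m <- s) Pr (A m))%E.

End Independence.

(* Borel sigma-algebra of the space of matrices, as the product sigma-algebra
   of the entries. *)
Definition mx_borel (R : realType) (n : nat) : set_system 'M[R]_n :=
  <<s [set B | exists i j, exists2 C : set R, measurable C &
                 B = [set A : 'M[R]_n | C (A i j)]] >>.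

(* [wt] is the generic random weight matrix, on its own probability space; the
   chain [st] and the weight matrices [stw m] used at the transitions m >= 1
   ([stw 0] is irrelevant) live on a second space, whose probability [ch_prob i]
   is the law of the chain started at i. *)
Record weighted_chain (R : realType) (n : nat) := WeightedChain {
  wt_disp : measure_display;
  wt_space : measurableType wt_disp;
  wt_prob : probability wt_space R;
  wt : wt_space -> 'M[R]_n;
  ch_disp : measure_display;
  ch_space : measurableType ch_disp;
  ch_prob : 'I_n -> probability ch_space R;
  st : nat -> ch_space -> 'I_n;
  stw : nat -> ch_space -> 'M[R]_n
}.

Arguments wt {R n} w _.
Arguments st {R n} w _ _.
Arguments stw {R n} w _ _.

Section WeightedChain.
Context (R : realType) (n : nat).
Implicit Types (E : rel 'I_n) (P : 'M[R]_n) (S : weighted_chain R n).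

Definition random_matrix d (T : measurableType d) (A : T -> 'M[R]_n) : Prop :=
  forall i j, measurable_fun setT (fun w => A w i j).

Definition random_weights E d (T : measurableType d) (A : T -> 'M[R]_n) : Prop :=
  random_matrix A /\ exists2 eps : R, 0 < eps & forall w, weights_on E eps (A w).

Definition finite_moments E S : Prop :=
  forall i j, E i j ->
    ('E_(wt_prob S)[(fun w => wt S w i j)] < +oo)%E /\
    ('E_(wt_prob S)[(fun w => wt S w i j ^+ 2)%R] < +oo)%E.

(* The Markov property is written with the conditional probability multiplied
   out, so that null histories need no special treatment. *)
Definition markov_chain P (i : 'I_n) d (T : measurableType d)
    (Pr : probability T R) (X : nat -> T -> 'I_n) : Prop :=
  [/\ forall m x, measurable [set w | X m w = x],
      Pr [set w | X 0 w = i] = 1%E &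
      forall m (x : nat -> 'I_n),
        Pr [set w | forall r, (r <= m.+1)%N -> X r w = x r] =
        (Pr [set w | forall r, (r <= m)%N -> X r w = x r]
           * (P (x m) (x m.+1))%:E)%E].

Definition sigma_weight S (m : nat) : set_system (ch_space S) :=
  preimage_set_system setT (stw S m) (@mx_borel R n).

Definition sigma_weights S : set_system (ch_space S) :=
  <<s [set A | exists2 m, (0 < m)%N & @sigma_weight S m A] >>.

Definition sigma_chain S : set_system (ch_space S) :=
  <<s [set A | exists m x, A = [set w | st S m w = x]] >>.

Definition iid_weights S : Prop := forall i,
  mutually_independent (ch_prob S i) [set m | (0 < m)%N] (@sigma_weight S) /\
  forall m (B : set 'M[R]_n), (0 < m)%N -> mx_borel B ->
    ch_prob S i (stw S m @^-1` B) = wt_prob S (wt S @^-1` B).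

Definition weights_indep_chain S : Prop :=
  forall i, independent_classes (ch_prob S i) (@sigma_chain S) (@sigma_weights S).

Definition weighted_chain_on E P S : Prop :=
  [/\ random_weights E (wt S) /\
        (forall m, (0 < m)%N -> random_weights E (stw S m)),
      finite_moments E S,
      (forall i, markov_chain P i (ch_prob S i) (st S)),
      iid_weights S &
      weights_indep_chain S].

Definition mean_weight S : 'M[R]_n :=
  \matrix_(i, j) fine ('E_(wt_prob S)[(fun w => wt S w i j)]).

(* +oo when j is never visited at a time m >= 1. *)
Definition first_passage S (j : 'I_n) (w : ch_space S) : \bar R :=
  ereal_inf [set m%:R%:E | m in [set m | (0 < m)%N /\ st S m w = j]].

Definition passage_weight S (j : 'I_n) (w : ch_space S) : \bar R :=
  (\sum_(1 <= m <oo | m%:R%:E <= first_passage j w)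
     (stw S m w (st S m.-1 w) (st S m w))%:E)%E.

Definition mean_passage S : 'M[R]_n :=
  \matrix_(i, j) fine (\int[ch_prob S i]_w passage_weight j w)%E.

End WeightedChain.

Section Formulas.
Context (R : realType) (n : nat).
Implicit Types (P W : 'M[R]_n) (pi : 'rV[R]_n).

Definition Ubar P W (i : 'I_n) : R := \sum_k P i k * W i k.

Definition Ytot pi P W : R := \sum_i pi 0 i * Ubar P W i.

Definition nvec pi P W : 'cV[R]_n := \col_i (pi 0 i * Ubar P W i).

Definition piW pi P W : 'rV[R]_n := \row_i (pi 0 i * Ubar P W i / Ytot pi P W).

Definition kemeny pi P (S : weighted_chain R n) : R :=
  \sum_i \sum_j piW pi P (mean_weight S) 0 i * mean_passage S i j
                  * piW pi P (mean_weight S) 0 j.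

Definition ones : 'cV[R]_n := const_mx 1.

Definition unit_col (l : 'I_n) : 'cV[R]_n := delta_mx l 0.

Definition dg (A : 'M[R]_n) : 'M[R]_n :=
  \matrix_(i, j) (if i == j then A i j else 0).

Definition Xi pi : 'M[R]_n := diag_mx pi.

Definition Zmx P pi : 'M[R]_n := invmx (1%:M - P + ones *m pi).

End Formulas.

Arguments ones {R n}.
Arguments unit_col {R n} l.

(* Main.v *)
Require Import Defs.
From HB Require Import structures.
From mathcomp Require Import all_boot all_order all_algebra.
From mathcomp Require Import all_classical all_reals all_analysis.
From mathcomp Require Import measurable_realfun ring lra.
Set Implicit Arguments.
Unset Strict Implicit.
Unset Printing Implicit Defensive.
Import Order.TTheory GRing.Theory Num.Theory.
Import numFieldNormedType.Exports.
Local Open Scope classical_set_scope.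
Local Open Scope ring_scope.

(** Along a sample path started at [i], the weight accumulated until the first
    visit to [j] is a sum over times [m] of the weight of the transition from
    [X_m] to [X_(m+1)], counted when [j] has not been hit at the times [1..m].
    This event and the two end points depend on the chain only, so independence
    replaces the random weight by its mean, and the event has the probability
    [(Q^m)(i,x) P(x,y)], where [Q] is [P] with column [j] erased (taboo
    probabilities, [taboo_probability]). With [u] the column of mean one-step
    weights this gives [M(i,j) = \sum_m (Q^m u)(i)] ([expected_passage_weight]).

    The column [v] given by the weighted Kemeny-Snell expression
      [Z u 1^T - 1 1^T (Z u 1^T)_dg + Y (I - Z + 1 1^T Z_dg) Xi^-1]
    solves [v = u + Q v] ([passage_formula_poisson], from [P Z = Z - I + 1 pi]).
    Since the entries of [u] are bounded below by a positive constant, any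
    solution of this equation is nonnegative, hence at least [u], so that
    [Q v = v - u <= theta v] with [theta < 1]. Thus [Q^N v] tends to [0] and the
    series sums to [v] ([poisson_series_cvg]): on the whole domain of weights,
    [M] is the Kemeny-Snell expression ([mean_passageE]).

    That expression is linear in the weights, and the line through [W] in the
    direction of an edge stays in the domain near [W]. So the derivative of [M]
    is the value of the expression at the elementary matrix of the edge, and
    that of [K] follows from the product and quotient rules, the normalised
    weights [piW] being quotients of affine functions along the line. *)

(** * Sums of powers of a substochastic matrix *)

Section PoissonEquation.
Context (R : realType) (n : nat).
Variables (Q : 'M[R]_n) (u M : 'cV[R]_n).
Hypothesis Q_ge0 : forall i j, 0 <= Q i j.
Hypothesis poissonM : M = u + Q *m M.

Lemma poisson_entry i : M i 0 = u i 0 + \sum_j Q i j * M j 0.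
Proof. by rewrite {1}poissonM !mxE. Qed.

(** Minimum principle: at a minimiser [a] with [M a 0 < 0], averaging with the
    substochastic row [Q a] gives at least [M a 0], and adding [u a 0 > 0]
    contradicts the equation. *)
Lemma poisson_ge0 : (forall i, \sum_j Q i j <= 1) -> (forall i, 0 < u i 0) ->
  forall i, 0 <= M i 0.
Proof.
move=> Q_le1 u_gt0 i.
have [a _ a_min] := @arg_minP _ R _ i xpredT (fun x => M x 0) isT.
apply: le_trans (a_min i isT); rewrite leNgt; apply/negP => Ma_lt0.
have : u a 0 + M a 0 <= M a 0.
  rewrite [leRHS]poisson_entry lerD2l.
  apply: (@le_trans _ _ (\sum_j Q a j * M a 0)).
    by rewrite -mulr_suml ler_niMl ?Q_le1 // ltW.
  by apply: ler_sum => j _; apply: ler_wpM2l => //; exact: a_min.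
by rewrite gerDr leNgt u_gt0.
Qed.

Lemma poisson_partial_sum N :
  \sum_(m < N) Q ^+ m *m u = M - Q ^+ N *m M.
Proof.
elim: N => [|N IHN]; first by rewrite big_ord0 expr0 mul1mx subrr.
rewrite big_ord_recr /= {}IHN {2}poissonM mulmxDr opprD addrA addrAC subrK.
by rewrite mulmxA exprSr.
Qed.

Lemma poisson_geometric_bound theta :
    0 <= theta -> (forall i, M i 0 - u i 0 <= theta * M i 0) ->
  forall N i, (Q ^+ N *m M) i 0 <= theta ^+ N * M i 0.
Proof.
move=> theta_ge0 contract; elim=> [|N IHN] i.
  by rewrite expr0 mul1mx mul1r.
rewrite exprS -mulmxA mxE.
apply: (@le_trans _ _ (\sum_j Q i j * (theta ^+ N * M j 0))).
  by apply: ler_sum => j _; exact: ler_wpM2l.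
rewrite (eq_bigr (fun j => theta ^+ N * (Q i j * M j 0))) => [|j _]; last first.
  by rewrite mulrCA.
rewrite -mulr_sumr exprSr -mulrA; apply: ler_wpM2l; first exact: exprn_ge0.
by have := contract i; rewrite {1}poisson_entry addrAC subrr add0r.
Qed.

(** Dominating [M] by [b] and minorising [u] by [e] gives [u >= (e / b) M], so
    that [Q] contracts [M] by the factor [1 - e / b] and the remainder
    [Q ^+ N *m M] of the partial sums vanishes. *)
Lemma poisson_series_cvg (e : R) :
    (forall i, \sum_j Q i j <= 1) -> 0 < e -> (forall i, e <= u i 0) ->
  forall i, (fun N => \sum_(m < N) (Q ^+ m *m u) i 0) @ \oo --> M i 0.
Proof.
move=> Q_le1 e_gt0 e_le i.
have u_gt0 j : 0 < u j 0 by exact: lt_le_trans (e_le j).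
have M_ge0 := poisson_ge0 Q_le1 u_gt0.
have u_leM j : u j 0 <= M j 0.
  by rewrite [leRHS]poisson_entry lerDl sumr_ge0 // => k _; rewrite mulr_ge0.
pose b := \sum_j M j 0.
have M_leb j : M j 0 <= b by rewrite /b (bigD1 j) //= lerDl sumr_ge0.
have b_gt0 : 0 < b.
  exact: lt_le_trans e_gt0 (le_trans (e_le i) (le_trans (u_leM i) (M_leb i))).
have eb_le1 : e / b <= 1.
  by rewrite ler_pdivrMr // mul1r (le_trans (e_le i) (le_trans (u_leM i) _)).
pose theta := 1 - e / b.
have theta_ge0 : 0 <= theta by rewrite subr_ge0.
have theta_lt1 : `|theta| < 1 by rewrite ger0_norm // gtrBl divr_gt0.
have contract j : M j 0 - u j 0 <= theta * M j 0.
  rewrite mulrBl mul1r lerB // (le_trans _ (e_le j)) //.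
  by rewrite mulrAC ler_pdivrMr // ler_wpM2l // ltW.
have QN_ge0 N j k : 0 <= (Q ^+ N) j k.
  elim: N j k => [|N IHN] j k; first by rewrite expr0 mxE ler0n.
  by rewrite exprS mxE sumr_ge0 // => h _; rewrite mulr_ge0.
have tail0 : (fun N => (Q ^+ N *m M) i 0) @ \oo --> (0 : R).
  apply: (@squeeze_cvgr _ _ _ _ (cst 0) (fun N => theta ^+ N * M i 0)).
  - near=> N; apply/andP; split; last exact: poisson_geometric_bound.
    by rewrite mxE sumr_ge0 // => j _; rewrite mulr_ge0.
  - exact: cvg_cst.
  - by rewrite -[X in _ --> X](mul0r (M i 0)); apply: cvgMl; exact: cvg_expr.
rewrite (_ : (fun N => _) = (fun N => M i 0 - (Q ^+ N *m M) i 0)).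
  by rewrite -[X in _ --> X]subr0; apply: cvgB => //; exact: cvg_cst.
apply/funext => N.
have := congr1 (fun A : 'cV[R]_n => A i 0) (poisson_partial_sum N).
by rewrite summxE => ->; rewrite !mxE.
Unshelve. all: by end_near. Qed.

End PoissonEquation.

(** * The fundamental matrix of an irreducible chain *)

Section FundamentalMatrix.
Context (R : realType) (n : nat).
Variables (P : 'M[R]_n) (pi : 'rV[R]_n).
Hypothesis P_ge0 : forall i j, 0 <= P i j.
Hypothesis P_sum1 : forall i, \sum_j P i j = 1.
Hypothesis irrP : irreducible P.
Hypothesis statP : stationary P pi.

Lemma stochastic_ones : P *m ones = ones.
Proof.
apply/matrixP => i j; rewrite !mxE -[RHS](P_sum1 i).
by apply: eq_bigr => h _; rewrite mxE mulr1.
Qed.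

Lemma stationary_ones : pi *m ones = 1%:M.
Proof.
case: statP => _ pi1 _; apply/matrixP => i j.
rewrite !ord1 !mxE eqxx -pi1 /=.
by apply: eq_bigr => h _; rewrite mxE mulr1.
Qed.

Lemma stochastic_expr m : (forall i j, 0 <= (P ^+ m) i j) /\
  (forall i, \sum_j (P ^+ m) i j = 1).
Proof.
elim: m => [|m [IH0 IH1]].
  split=> i; first by move=> j; rewrite expr0 mxE ler0n.
  rewrite expr0 (bigD1 i) //= big1 ?addr0 ?mxE ?eqxx // => j ji.
  by rewrite mxE eq_sym (negbTE ji).
split=> i; first by move=> j; rewrite exprS mxE sumr_ge0 // => h _; rewrite mulr_ge0.
under eq_bigr do rewrite exprSr mxE.
rewrite exchange_big /= -[RHS](IH1 i); apply: eq_bigr => j _.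
by rewrite -mulr_sumr P_sum1 mulr1.
Qed.

Lemma stationary_gt0 i : 0 < pi 0 i.
Proof.
case: statP => pi_ge0 pi1 piP.
have [a pia_gt0] : exists a, 0 < pi 0 a.
  apply: contrapT => /forallNP noa.
  move: pi1; rewrite big1 => [/eqP|a _]; first by rewrite eq_sym oner_eq0.
  by apply/eqP; rewrite eq_le pi_ge0 andbT leNgt; apply/negP/noa.
have [m Pm_gt0] := irrP a i.
have piPm : pi = pi *m P ^+ m.
  elim: m {Pm_gt0} => [|m IHm]; first by rewrite expr0 mulmx1.
  by rewrite exprS mulmxA piP.
rewrite piPm mxE (bigD1 a) //= ltr_wpDr ?mulr_gt0 // sumr_ge0 // => j _.
by rewrite mulr_ge0 //; case: (stochastic_expr m).
Qed.

(** Maximum principle: by irreducibility a power of [P] charges any given state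
    from a maximiser of [v], and an average of [v] equal to its maximum forces
    equality wherever the average puts mass. *)
Lemma harmonic_constant (v : 'cV[R]_n) : P *m v = v -> forall i j, v i 0 = v j 0.
Proof.
move=> Pv i0 j0.
have [a _ a_max] := @arg_maxP _ R _ i0 xpredT (fun x => v x 0) isT.
suff va j : v j 0 = v a 0 by rewrite !va.
have [m Pm_gt0] := irrP a j; have [Pm_ge0 Pm1] := stochastic_expr m.
have Pmv : P ^+ m *m v = v.
  elim: m {Pm_gt0 Pm_ge0 Pm1} => [|m IHm]; first by rewrite expr0 mul1mx.
  by rewrite exprSr -mulmxA Pv.
have /eqP : \sum_k (P ^+ m) a k * (v a 0 - v k 0) = 0.
  under eq_bigr do rewrite mulrBr.
  rewrite sumrB -mulr_suml Pm1 mul1r; apply/eqP; rewrite subr_eq0.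
  by rewrite -{1}Pmv mxE.
rewrite psumr_eq0 => [/allP/(_ j)|k _]; last first.
  by rewrite mulr_ge0 // subr_ge0; exact: a_max.
rewrite mem_index_enum => /(_ isT); rewrite /= mulf_eq0 gt_eqF //= subr_eq0.
by move/eqP.
Qed.

Let A := 1%:M - P + ones *m pi.

(** A kernel vector is annihilated by [pi], hence is [P]-harmonic, hence
    constant, and a constant annihilated by [pi] is zero. *)
Lemma fundamental_unit : A \in unitmx.
Proof.
rewrite -unitmx_tr -row_free_unit; apply: inj_row_free => w wA.
case: (statP) => _ _ piP.
have Aw : A *m w^T = 0 by rewrite -[A]trmxK -trmx_mul wA trmx0.
have piw : pi *m w^T = 0.
  rewrite -(mulmx0 _ pi) -Aw mulmxA mulmxDr mulmxBr mulmx1 piP subrr add0r.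
  by rewrite mulmxA stationary_ones mul1mx.
have Pw : P *m w^T = w^T.
  apply/eqP; rewrite eq_sym -subr_eq0 -{1}(mul1mx w^T) -mulmxBl.
  by move: Aw; rewrite mulmxDl -mulmxA piw mulmx0 addr0 => ->.
have cw := harmonic_constant Pw.
apply/rowP => j; rewrite [RHS]mxE.
have := congr1 (fun B : 'M[R]_1 => B 0 0) piw; rewrite !mxE => piw0.
have -> : w 0 j = \sum_i pi 0 i * w^T i 0; last by [].
case: (statP) => _ pi1 _; rewrite -[LHS]mul1r -pi1 mulr_suml.
by apply: eq_bigr => i _; rewrite (cw i j) mxE.
Qed.

Lemma stationary_Zmx : pi *m Zmx P pi = pi.
Proof.
case: (statP) => _ _ piP.
have piA : pi *m A = pi.
  rewrite mulmxDr mulmxBr mulmx1 piP subrr add0r mulmxA stationary_ones.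
  by rewrite mul1mx.
by rewrite /Zmx -/A -{1}piA -mulmxA mulmxV ?mulmx1 // fundamental_unit.
Qed.

Lemma mulmx_Zmx : P *m Zmx P pi = Zmx P pi - 1%:M + ones *m pi.
Proof.
have : A *m Zmx P pi = 1%:M by rewrite mulmxV // fundamental_unit.
rewrite /A mulmxDl mulmxBl mul1mx -mulmxA stationary_Zmx => <-.
by rewrite opprD addrA subrK opprB addrC subrK.
Qed.

End FundamentalMatrix.

(** * The weighted Kemeny-Snell formula *)

Section PassageFormula.
Context (R : realType) (n : nat).
Variables (P : 'M[R]_n) (pi : 'rV[R]_n).
Implicit Types (V : 'M[R]_n).
Local Notation one := (@ones R n).

Definition Ucol V : 'cV[R]_n := \col_i Ubar P V i.

(** The Kemeny-Snell matrix of mean first passage times, with the unit time of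
    each step replaced by the mean weight [V]. *)
Definition passage_formula V : 'M[R]_n :=
  let Z := Zmx P pi in let J := one *m one^T in
  Z *m Ucol V *m one^T - J *m dg (Z *m Ucol V *m one^T)
  + Ytot pi P V *: ((1%:M - Z + J *m dg Z) *m invmx (Xi pi)).

(** Erasing column [j] forbids the chain to enter [j]. *)
Definition taboo (j : 'I_n) : 'M[R]_n := \matrix_(x, y) (P x y *+ (y != j)).

Lemma Ubar_line V V' h i : Ubar P (h *: V + V') i = h * Ubar P V i + Ubar P V' i.
Proof.
rewrite /Ubar mulr_sumr -big_split /=; apply: eq_bigr => j _.
by rewrite !mxE mulrDr mulrCA.
Qed.

Lemma Ytot_line V V' h :
  Ytot pi P (h *: V + V') = h * Ytot pi P V + Ytot pi P V'.
Proof.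
rewrite /Ytot mulr_sumr -big_split /=; apply: eq_bigr => i _.
by rewrite Ubar_line mulrDr mulrCA.
Qed.

Lemma mulmx_ones_dg (A : 'M[R]_n) i j : (one *m one^T *m dg A) i j = A j j.
Proof.
rewrite mxE (bigD1 j) //= big1 ?addr0 => [|k kj].
  by rewrite !mxE big_ord1 !mxE eqxx !mul1r.
by rewrite [dg A k j]mxE (negbTE kj) mulr0.
Qed.

Lemma mulmx_ones_tr (v : 'cV[R]_n) i j : (v *m one^T) i j = v i 0.
Proof. by rewrite mxE big_ord1 !mxE mulr1. Qed.

Hypothesis pi_gt0 : forall i, 0 < pi 0 i.

Lemma mulmx_invXi (A : 'M[R]_n) i j : (A *m invmx (Xi pi)) i j = A i j / pi 0 j.
Proof.
have XiV : diag_mx (\row_k (pi 0 k)^-1) *m Xi pi = 1%:M.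
  apply/matrixP => x y; rewrite mul_mx_diag !mxE.
  by case: eqP => [->|_]; rewrite ?mulr1n ?mulVf ?gt_eqF ?mulr0n ?mul0r.
have Xi_unit : Xi pi \in unitmx by have [] := mulmx1_unit XiV.
have -> : invmx (Xi pi) = diag_mx (\row_k (pi 0 k)^-1).
  by rewrite -[LHS]mul1mx -XiV -mulmxA mulmxV // mulmx1.
by rewrite mul_mx_diag !mxE.
Qed.

Lemma passage_formulaE V i j : passage_formula V i j =
  (Zmx P pi *m Ucol V) i 0 - (Zmx P pi *m Ucol V) j 0
  + Ytot pi P V * (((i == j)%:R - Zmx P pi i j + Zmx P pi j j) / pi 0 j).
Proof.
rewrite /passage_formula; set Z := Zmx P pi; set v := Z *m Ucol V.
rewrite mxE [in RHS]addrC addrC; congr (_ + _).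
  by rewrite mxE mulmx_invXi mxE mulmx_ones_dg !mxE.
by rewrite mxE [X in _ + X]mxE mulmx_ones_dg !mulmx_ones_tr.
Qed.

Lemma passage_formula_line V V' h :
  passage_formula (h *: V + V') = h *: passage_formula V + passage_formula V'.
Proof.
have UcolD : Ucol (h *: V + V') = h *: Ucol V + Ucol V'.
  by apply/matrixP => i z; rewrite !mxE Ubar_line.
apply/matrixP => i j; rewrite [RHS]mxE [X in _ = X + _]mxE !passage_formulaE.
rewrite UcolD Ytot_line mulmxDr -scalemxAr.
have lineE (x y : 'cV[R]_n) k : (h *: x + y) k 0 = h * x k 0 + y k 0.
  by rewrite !mxE.
by rewrite !lineE; ring.
Qed.

Hypothesis P_ge0 : forall i j, 0 <= P i j.
Hypothesis P_sum1 : forall i, \sum_j P i j = 1.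
Hypothesis irrP : irreducible P.
Hypothesis statP : stationary P pi.

(** One-step analysis of the first passage: the first step from [x] costs
    [Ubar x] on average, and the passage goes on unless the step reaches [j]. *)
Lemma passage_formula_poisson V j :
  col j (passage_formula V) = Ucol V + taboo j *m col j (passage_formula V).
Proof.
pose Z := Zmx P pi; pose Y := Ytot pi P V; pose v := Z *m Ucol V.
have PZ x y : \sum_k P x k * Z k y = Z x y - (x == y)%:R + pi 0 y.
  have := congr1 (fun A : 'M[R]_n => A x y) (mulmx_Zmx P_ge0 P_sum1 irrP statP).
  by rewrite mxE => ->; rewrite !mxE big_ord1 !mxE mul1r.
have Pv x : \sum_k P x k * v k 0 = v x 0 - Ubar P V x + Y.
  have : P *m v = v - Ucol V + ones *m (pi *m Ucol V).
    rewrite /v mulmxA mulmx_Zmx // mulmxDl mulmxBl mul1mx.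
    by rewrite -mulmxA.
  move/(congr1 (fun A : 'cV[R]_n => A x 0)); rewrite mxE => ->.
  rewrite !mxE big_ord1 !mxE mul1r; congr (_ + _).
  by apply: eq_bigr => k _; rewrite mxE.
apply/matrixP => x z.
rewrite ord1 [LHS]mxE [RHS]mxE [X in X + _]mxE [X in _ + X]mxE.
(* [f] is the formula with its diagonal value removed, which is what the taboo
   matrix sees: the Kronecker term of the formula lives in the erased column. *)
pose f y := v y 0 - v j 0 + Y * ((Z j j - Z y j) / pi 0 j).
have -> : \sum_k taboo j x k * col j (passage_formula V) k 0
    = \sum_k P x k * f k.
  apply: eq_bigr => k _; rewrite [X in X * _]mxE [X in _ * X]mxE.
  rewrite passage_formulaE -/Z -/v -/Y /f.
  have [->|kj] := eqVneq k j.
    by rewrite mulr0n !subrr !(mul0r, mulr0, addr0).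
  by rewrite mulr1n sub0r [- _ + _]addrC.
have -> : \sum_k P x k * f k
    = \sum_k P x k * v k 0 + \sum_k P x k * (Y * Z j j / pi 0 j - v j 0)
      - Y / pi 0 j * \sum_k P x k * Z k j.
  rewrite mulr_sumr -big_split -sumrB /=; apply: eq_bigr => k _.
  by rewrite /f; ring.
rewrite Pv PZ -mulr_suml P_sum1 passage_formulaE -/Z -/v -/Y.
by have := gt_eqF (pi_gt0 j) => /negbT pi0; field.
Qed.

End PassageFormula.

(** * Expectations under independence *)

Section Independence.
Context (R : realType).

(** Restricting to the positive half-line loses nothing for a nonnegative
    function, and it makes the law of [\1_A * f] a multiple of that of [f]: only
    the atom at [0] distinguishes them when [A] and [f] are independent. *)
Lemma integral_law d (T : measurableType d) (Pr : probability T R) (g : T -> R) :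
    measurable_fun setT g -> (forall w, 0 <= g w) ->
  (\int[Pr]_w (g w)%:E
   = \int[pushforward Pr g]_(x in `]0%R, +oo[) x%:E)%E.
Proof.
move=> mg g_ge0; rewrite ge0_integral_pushforward //; last first.
  by move=> x; rewrite inE /= in_itv /= andbT lee_fin => /ltW.
rewrite [RHS]integral_mkcond; apply: eq_integral => w _.
rewrite patchE; case: ifPn => // /negP.
rewrite inE /= in_itv /= andbT => /negP; rewrite -leNgt => gw.
by congr EFin; apply/eqP; rewrite eq_le gw g_ge0.
Qed.

Lemma integral_indep d (T : measurableType d) (Pr : probability T R)
    d' (T' : measurableType d') (Pr' : probability T' R)
    (A : set T) (f : T -> R) (f' : T' -> R) :
    measurable A -> measurable_fun setT f -> measurable_fun setT f' ->
    (forall w, 0 <= f w) -> (forall w, 0 <= f' w) ->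
    (forall C, measurable C -> Pr (A `&` f @^-1` C) = (Pr A * Pr' (f' @^-1` C))%E) ->
  (\int[Pr]_w (\1_A w * f w)%:E = Pr A * \int[Pr']_w (f' w)%:E)%E.
Proof.
move=> mA mf mf' f_ge0 f'_ge0 indep.
have mfA : measurable_fun setT (fun w => \1_A w * f w).
  by apply: measurable_funM => //; exact: measurable_indic.
rewrite [LHS]integral_law //; last by move=> w; rewrite mulr_ge0 // indicE ler0n.
rewrite integral_law //.
have [c PrA] : exists c : {nonneg R}, Pr A = c%:num%:E.
  have PrA_ge0 : 0 <= fine (Pr A) by exact: fine_ge0.
  by exists (NngNum PrA_ge0); rewrite /= fineK // fin_num_measure.
rewrite PrA -(ge0_integral_mscale (distribution Pr' (mfun_Sub (mem_set mf'))));
  last first.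
- by move=> x; rewrite /= in_itv /= andbT lee_fin => /ltW.
- exact/measurable_EFinP.
- exact: measurable_itv.
apply: (@eq_measure_integral _ _ _ _ _
  (distribution Pr (mfun_Sub (mem_set mfA)))) => C mC C_gt0.
change (Pr ((fun w => \1_A w * f w)%R @^-1` C)
  = c%:num%:E * Pr' (f' @^-1` C))%E.
rewrite -PrA -indep //; congr (Pr _).
apply/seteqP; split=> w /=; rewrite indicE.
  have [wA|wA] := boolP (w \in A); first by rewrite mul1r; split=> //; exact: set_mem.
  by rewrite mul0r => /C_gt0; rewrite /= in_itv /= ltxx.
by case=> wA Cfw; rewrite mem_set // mul1r.
Qed.
End Independence.

Section Fibers.
Context (R : realType) d (T : measurableType d) (Pr : probability T R).

Lemma measure_fiber_sum (I : finType) (f : T -> I) (A : set T) :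
    measurable A -> (forall i, measurable [set w | f w = i]) ->
  (Pr A = \sum_i Pr (A `&` [set w | f w = i]))%E.
Proof.
move=> mA mf.
have mseq (s : seq I) : measurable [set w | f w \in s].
  elim: s => [|i s IHs]; first by rewrite (_ : mkset _ = set0) //;
    apply/seteqP; split=> w.
  rewrite (_ : mkset _ = [set w | f w = i] `|` [set w | f w \in s]).
    exact: measurableU.
  apply/seteqP; split=> w /=; rewrite inE; first by case/orP=> [/eqP|]; [left|right].
  by case=> [->|->]; rewrite ?eqxx ?orbT.
have sumE (s : seq I) : uniq s ->
    (Pr (A `&` [set w | f w \in s]) = \sum_(i <- s) Pr (A `&` [set w | f w = i]))%E.
  elim: s => [_|i s IHs /= /andP[is_ us]].
    rewrite big_nil (_ : mkset _ = set0) ?setI0 ?measure0 //.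
    by apply/seteqP; split=> w.
  rewrite big_cons -IHs // -measureU; last first.
  - apply/seteqP; split=> w //= -[[_ fw] [_]].
    by rewrite fw (negbTE is_).
  - exact: measurableI.
  - exact: measurableI.
  congr (Pr _); rewrite -setIUr; congr (_ `&` _).
  apply/seteqP; split=> w /=; rewrite inE; first by case/orP=> [/eqP|]; [left|right].
  by case=> [->|->]; rewrite ?eqxx ?orbT.
rewrite -sumE ?index_enum_uniq //; congr (Pr _).
rewrite (_ : mkset _ = setT) ?setIT //.
by apply/seteqP; split=> // w _ /=; rewrite mem_index_enum.
Qed.

End Fibers.

(** * Taboo probabilities of a Markov chain *)

Lemma measurable_history d (T : measurableType d) (I : finType)
    (X : nat -> T -> I) m (b : pred {ffun 'I_m -> I}) :
    (forall r x, measurable [set w | X r w = x]) ->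
  measurable [set w | b [ffun r : 'I_m => X r w]].
Proof.
move=> mX; rewrite (_ : mkset _ = \bigcup_(g in [set g | b g])
    \bigcap_(r in [set: 'I_m]) [set w | X r w = g r]).
  by do 2!(apply: fin_bigcup_measurable || apply: fin_bigcap_measurable) => // ? _.
apply/seteqP; split=> w /= => [bw|[g bg Xg]].
  by exists [ffun r : 'I_m => X r w] => // r _ /=; rewrite ffunE.
rewrite (_ : [ffun _ => _] = g) //.
by apply/ffunP => r; rewrite ffunE; exact: Xg.
Qed.

(** Time [0] is excluded, because a first passage is a first return when the
    chain starts at [j]. *)
Definition avoids (T I : Type) (X : nat -> T -> I) j m : set T :=
  [set w | forall r, (0 < r <= m)%N -> X r w <> j].

Lemma measurable_avoids d (T : measurableType d) (I : Type) (X : nat -> T -> I)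
    j m :
  (forall r x, measurable [set w | X r w = x]) -> measurable (avoids X j m).
Proof.
move=> mX; rewrite (_ : avoids X j m =
    \bigcap_(r in [set r | (0 < r <= m)%N]) ~` [set w | X r w = j]) //.
by apply: bigcap_measurableType => r _; exact: measurableC.
Qed.

Section TabooProbabilities.
Context (R : realType) (n : nat) (P : 'M[R]_n) (i : 'I_n).
Context d (T : measurableType d) (Pr : probability T R) (X : nat -> T -> 'I_n).
Hypothesis chainX : markov_chain P i Pr X.

Let mX m x : measurable [set w | X m w = x]. Proof. by case: chainX. Qed.

Let hist m w := [ffun r : 'I_m.+1 => X r w].

Let measurable_hist m (b : pred {ffun 'I_m.+1 -> 'I_n}) :
  measurable [set w | b (hist m w)].
Proof. exact: (measurable_history b mX). Qed.

(** The chain is specified by the probabilities of single trajectories. Splitting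
    an event of the past into trajectories turns this into the usual Markov
    property. *)
Lemma markov_property m (b : pred {ffun 'I_m.+1 -> 'I_n}) x y :
  (Pr ([set w | b (hist m w)] `&` [set w | X m w = x] `&` [set w | X m.+1 w = y])
   = Pr ([set w | b (hist m w)] `&` [set w | X m w = x]) * (P x y)%:E)%E.
Proof.
have mhist (g : {ffun 'I_m.+1 -> 'I_n}) : measurable [set w | hist m w = g].
  by rewrite (_ : mkset _ = [set w | (hist m w == g)]);
     [exact: (measurable_hist (pred1 g)) | apply/seteqP; split=> w /= /eqP].
have mB := measurable_hist b.
rewrite (measure_fiber_sum Pr (f := hist m)) //; last first.
  by apply: measurableI; [exact: measurableI|].
rewrite [in RHS](measure_fiber_sum Pr (f := hist m)) //; last exact: measurableI.
rewrite ge0_sume_distrl //; apply: eq_bigr => g _.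
have [/andP[bg /eqP gm]|bgm] := boolP (b g && (g ord_max == x)); last first.
  rewrite [in LHS]setIAC (_ : _ `&` [set w | hist m w = g] = set0).
    by rewrite set0I !measure0 mul0e.
  apply/seteqP; split=> w //= -[[bw Xm] gw]; case/negP: bgm.
  by rewrite -gw bw ffunE Xm eqxx.
(* The trajectory following [g] up to time [m] and then [y]: its value at [m.+1]
   is the default branch. *)
pose z r := if (r <= m)%N then g (inord r) else y.
have zP w : hist m w = g <-> forall r, (r <= m)%N -> X r w = z r.
  split=> [gw r rm|Xz]; first by rewrite /z rm -gw ffunE inordK.
  apply/ffunP => r; have rm : (r <= m)%N by rewrite -ltnS.
  by rewrite ffunE Xz // /z rm inord_val.
have zm : z m = x.
  by rewrite /z leqnn -gm; congr (g _); apply/val_inj; rewrite /= inordK.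
have zm1 : z m.+1 = y by rewrite /z ltnn.
have Xm w : hist m w = g -> X m w = x by move=> /zP ->.
case: chainX => _ _ /(_ m z); rewrite zm zm1.
rewrite (_ : [set w | forall r, (r <= m)%N -> _] = [set w | b (hist m w)] `&`
  [set w | X m w = x] `&` [set w | hist m w = g]); last first.
  apply/seteqP; split=> w /=; last by case=> _ /zP.
  by move=> /zP gw; rewrite gw; do 2!split => //; exact: Xm.
move=> <-; congr (Pr _); apply/seteqP; split=> w /=.
  case=> -[_ Xy] /zP Xz r; rewrite leq_eqVlt => /predU1P[->|/Xz //].
  by rewrite zm1.
move=> Xz; have gw : hist m w = g by apply/zP => r rm; apply/Xz/leqW.
by split=> //; split; [split; [rewrite gw | exact: Xm] | rewrite -zm1 Xz].
Qed.

Let avoidsE j m : avoids X j m = [set w |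
  [pred g : {ffun 'I_m.+1 -> 'I_n} | [forall r : 'I_m.+1, (0 < r)%N ==> (g r != j)]]
    (hist m w)].
Proof.
apply/seteqP; split=> w /= avw.
  apply/forallP => r; apply/implyP => r0; rewrite ffunE; apply/eqP/avw.
  by rewrite r0 -ltnS /=.
move=> r /andP[r0 rm]; rewrite -ltnS in rm.
by have /forallP/(_ (Ordinal rm)) := avw; rewrite r0 ffunE /= => /eqP.
Qed.

Lemma avoids_markov j m x y :
  (Pr (avoids X j m `&` [set w | X m w = x] `&` [set w | X m.+1 w = y])
   = Pr (avoids X j m `&` [set w | X m w = x]) * (P x y)%:E)%E.
Proof. by rewrite avoidsE markov_property. Qed.

(** The induction on [m] decomposes along the position at time [m]; the erased
    column gives no mass to the paths entering [j] at the last step. *)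
Lemma taboo_probability j m x :
  Pr (avoids X j m `&` [set w | X m w = x]) = ((taboo P j ^+ m) i x)%:E.
Proof.
elim: m x => [|m IHm] x.
  rewrite (_ : avoids X j 0 = setT) ?setTI; last first.
    by apply/seteqP; split=> // w _ r; rewrite leqn0; case: r.
  case: chainX => _ X0 _; rewrite expr0 mxE.
  have [<-|ix] := eqVneq i x; first by rewrite X0.
  apply/eqP; rewrite eq_le measure_ge0 andbT.
  apply: (@le_trans _ _ (Pr (~` [set w | X 0 w = i]))).
    apply: le_measure; rewrite ?inE //; first exact: measurableC.
    by move=> w /= -> /eqP; rewrite eq_sym (negbTE ix).
  by rewrite probability_setC // X0 subee.
rewrite exprSr mxE.
have [->|xj] := eqVneq x j.
  rewrite (_ : _ `&` _ = set0) ?measure0; last first.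
    by apply/seteqP; split=> w //= -[/(_ m.+1)]; rewrite ltnSn => /(_ isT).
  by rewrite big1 // => y _; rewrite [taboo P j y j]mxE eqxx mulr0n mulr0.
rewrite (_ : _ `&` _ = avoids X j m `&` [set w | X m.+1 w = x]); last first.
  apply/seteqP; split=> w /= -[avw Xx]; split=> // r /andP[r0 rm].
    by apply: avw; rewrite r0 ltnW.
  move: rm; rewrite leq_eqVlt => /predU1P[->|rm]; first by rewrite Xx; apply/eqP.
  by apply: avw; rewrite r0.
rewrite (measure_fiber_sum Pr (f := X m)) //; last first.
  by apply: measurableI => //; exact: (measurable_avoids _ _ mX).
rewrite -sumEFin; apply: eq_bigr => y _.
rewrite setIAC avoids_markov IHm [taboo P j y x]mxE xj mulr1n.
by rewrite EFinM.
Qed.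

End TabooProbabilities.

(** * Expected weight of a first passage *)

Section ExpectedPassageWeight.
Context (R : realType) (n : nat) (E : rel 'I_n) (P : 'M[R]_n).
Context (S : weighted_chain R n) (chainS : weighted_chain_on E P S).

Definition transition_event j m x y : set (ch_space S) :=
  avoids (st S) j m `&` [set w | st S m w = x] `&` [set w | st S m.+1 w = y].

Lemma le_first_passage j m w :
  (m.+1%:R%:E <= first_passage j w)%E <-> avoids (st S) j m w.
Proof.
split=> [/ereal_infP le_fp r /andP[r_gt0 rm] Xr|avw].
  have : (m.+1%:R%:E <= r%:R%:E :> \bar R)%E by apply: le_fp; exists r.
  by rewrite lee_fin ler_nat ltnNge rm.
apply/ereal_infP => _ [r [r_gt0 Xr] <-]; rewrite lee_fin ler_nat ltnNge.
by apply/negP => rm; apply: (avw r) => //; rewrite r_gt0.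
Qed.

Lemma weights_ge0 (A : 'M[R]_n) eps : 0 < eps -> weights_on E eps A ->
  forall x y, 0 <= A x y.
Proof.
move=> eps_gt0 [A_ge A_0] x y; have [/A_ge|/A_0 ->//] := boolP (E x y).
by apply: le_trans; exact: ltW.
Qed.

Lemma wt_ge0 w x y : 0 <= wt S w x y.
Proof.
by case: chainS => -[[_ [eps e0 wtE]] _] _ _ _ _; exact: weights_ge0 (wtE w) x y.
Qed.

Lemma stw_ge0 m w x y : 0 <= stw S m.+1 w x y.
Proof.
case: chainS => -[_ /(_ m.+1 isT)[_ [eps e0 stwE]]] _ _ _ _.
exact: weights_ge0 (stwE w) x y.
Qed.

Lemma measurable_stw m x y :
  measurable_fun setT (fun w => stw S m.+1 w x y).
Proof. by case: chainS => -[_ /(_ m.+1 isT)[]]. Qed.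

Lemma measurable_st m x : measurable [set w | st S m w = x].
Proof. by case: chainS => _ _ /(_ x)[]. Qed.

Lemma measurable_transition_event j m x y :
  measurable (transition_event j m x y).
Proof.
apply: measurableI; last exact: measurable_st.
by apply: measurableI; [apply: measurable_avoids|]; exact: measurable_st.
Qed.

(** Measurability for the generated sigma-algebra is measurability on the type
    carrying it, so the closure properties of measurable sets apply. *)
Lemma sigma_chain_transition_event j m x y :
  @sigma_chain R n S (transition_event j m x y).
Proof.
set G := [set A | exists m x, A = [set w | st S m w = x]].
have mst r z : measurable ([set w | st S r w = z] : set (g_sigma_algebraType G)).
  by apply: sub_gen_smallest; exists r, z.
have : measurable (transition_event j m x y : set (g_sigma_algebraType G)).
  apply: measurableI; last exact: mst.
  by apply: measurableI; [apply: measurable_avoids|]; exact: mst.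
by [].
Qed.

(** The integral is finite on edges by the moment assumption and zero elsewhere,
    so that taking its real part loses nothing. *)
Lemma mean_weightE x y :
  (\int[wt_prob S]_w (wt S w x y)%:E = (mean_weight S x y)%:E)%E.
Proof.
rewrite mxE unlock fineK // ge0_fin_numE; last first.
  by apply: integral_ge0 => w _; rewrite lee_fin wt_ge0.
case: (boolP (E x y)) => Exy.
  by case: chainS => _ /(_ x y Exy)[+ _] _ _ _; rewrite unlock.
rewrite (_ : (fun w => _) = cst 0%E) ?integral0 //.
apply/funext => w /=; case: chainS => -[[_ [eps _ /(_ w)[_ wt0]]] _] _ _ _ _.
by rewrite wt0.
Qed.

(** The event is in the sigma-algebra of the chain, hence independent of the
    weight matrix, whose law is that of the generic one. *)
Lemma expected_transition_weight i j m x y :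
  (\int[ch_prob S i]_w
      (\1_(transition_event j m x y) w * stw S m.+1 w x y)%:E
   = ((taboo P j ^+ m) i x * P x y * mean_weight S x y)%:E)%E.
Proof.
have [[[mwt _] _] _ markovS /(_ i)[_ identS] indepS] := chainS.
rewrite (integral_indep (Pr' := wt_prob S) (f' := fun w => wt S w x y)).
- rewrite mean_weightE (avoids_markov (markovS i)).
  by rewrite (taboo_probability (markovS i)) -!EFinM.
- exact: measurable_transition_event.
- exact: measurable_stw.
- exact: mwt.
- by move=> w; exact: stw_ge0.
- by move=> w; exact: wt_ge0.
move=> C mC; pose B := [set A : 'M[R]_n | C (A x y)].
have mB : mx_borel B by apply: sub_gen_smallest; exists x, y, C.
have -> : (fun w => wt S w x y) @^-1` C = wt S @^-1` B by [].
have -> : (fun w => stw S m.+1 w x y) @^-1` C = stw S m.+1 @^-1` B by [].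
rewrite -(identS m.+1 B isT mB); apply: indepS.
  exact: sigma_chain_transition_event.
apply: sub_gen_smallest; exists m.+1 => //; exists B => //.
by rewrite setTI.
Qed.

(** At each time exactly one pair of states is the current transition, so the
    sum over pairs has at most one nonzero term; writing it this way makes the
    weight of a fixed pair, independent of the chain, appear. *)
Lemma passage_weightE j w :
  (passage_weight j w = \sum_(m <oo) \sum_(p : 'I_n * 'I_n)
    (\1_(transition_event j m p.1 p.2) w * stw S m.+1 w p.1 p.2)%:E)%E.
Proof.
rewrite /passage_weight eseries_cond eseries_mkcond.
(* Time [0] does not contribute; giving it the value [0] makes all terms
   nonnegative, as the shift of the index requires. *)
pose F m : \bar R := if (m%:R%:E <= first_passage j w)%E && (0 < m)%N
  then (stw S m w (st S m.-1 w) (st S m w))%:E else 0%E.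
rewrite -[LHS]/(\sum_(m <oo) F m)%E.
have F_ge0 m : (0 <= F m)%E.
  rewrite /F; case: m => [|m]; first by rewrite andbF.
  by case: ifP => // _; rewrite lee_fin stw_ge0.
rewrite nneseries_recl // {1}/F andbF add0e -nneseries_addn //.
apply: eq_eseriesr => m _; rewrite addn1 /F andbT /=.
have off p : p != (st S m w, st S m.+1 w) ->
    \1_(transition_event j m p.1 p.2) w = 0 :> R.
  move=> pXX; rewrite indicE memNset // => -[[_ /= X1] /= X2].
  by rewrite X1 X2 -surjective_pairing eqxx in pXX.
rewrite (bigD1 (st S m w, st S m.+1 w)) //= big1 ?adde0 => [|p /off ->]; last first.
  by rewrite mul0r.
rewrite indicE; case: ifPn => [/le_first_passage avw|/negP avw].
  by rewrite mem_set ?mul1r.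
by rewrite memNset ?mul0r // => -[[/le_first_passage]].
Qed.

Lemma expected_passage_weight i j :
  (\int[ch_prob S i]_w passage_weight j w
   = \sum_(m <oo) ((taboo P j ^+ m *m Ucol P (mean_weight S)) i 0)%:E)%E.
Proof.
have term_ge0 m p w :
    (0 <= (\1_(transition_event j m p.1 p.2) w * stw S m.+1 w p.1 p.2)%:E)%E.
  by rewrite lee_fin mulr_ge0 ?stw_ge0 // indicE ler0n.
have mterm m (p : 'I_n * 'I_n) : measurable_fun setT (fun w =>
    (\1_(transition_event j m p.1 p.2) w * stw S m.+1 w p.1 p.2)%:E : \bar R).
  apply/measurable_EFinP; apply: measurable_funM; last exact: measurable_stw.
  by apply: measurable_indic; exact: measurable_transition_event.
under eq_integral do rewrite passage_weightE.
rewrite integral_nneseries //; last 2 first.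
- by move=> m; exact: emeasurable_sum.
- by move=> m w _; exact: sume_ge0.
apply: eq_eseriesr => m _; rewrite ge0_integral_sum //.
rewrite (eq_bigr _ (fun p _ => expected_transition_weight i j m p.1 p.2)).
rewrite sumEFin; congr EFin.
rewrite -(pair_bigA _ (fun x y =>
  (taboo P j ^+ m) i x * P x y * mean_weight S x y)) /= mxE.
apply: eq_bigr => x _; rewrite mxE mulr_sumr.
by apply: eq_bigr => y _; rewrite mulrA.
Qed.

End ExpectedPassageWeight.

Section MeanPassage.
Context (R : realType) (n : nat) (E : rel 'I_n) (P : 'M[R]_n) (pi : 'rV[R]_n).
Hypothesis graphEP : markovian_graph E P.
Hypothesis statP : stationary P pi.

Lemma graph_ge0 i j : 0 <= P i j.
Proof.
case: graphEP => _ [P_E P_0 _] _ _.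
by have [/P_E|/P_0 ->] := boolP (E i j).
Qed.

Lemma graph_sum1 i : \sum_j P i j = 1.
Proof. by case: graphEP => _ []. Qed.

Lemma Ubar_ge V eps : weights_on E eps V -> forall i, eps <= Ubar P V i.
Proof.
case: graphEP => _ [_ P_0 P_1] _ _ [V_ge _] i.
rewrite -[eps]mul1r -(P_1 i) mulr_suml; apply: ler_sum => j _.
have [Eij|/P_0 ->] := boolP (E i j); last by rewrite !mul0r.
by rewrite ler_wpM2l ?graph_ge0 ?V_ge.
Qed.

Lemma graph_stationary_gt0 i : 0 < pi 0 i.
Proof.
have irrP : irreducible P by case: graphEP.
exact: (stationary_gt0 graph_ge0 graph_sum1 irrP statP).
Qed.

Lemma taboo_ge0 j x y : 0 <= taboo P j x y.
Proof. by rewrite mxE mulrn_wge0 // graph_ge0. Qed.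

Lemma taboo_sum_le1 j x : \sum_y taboo P j x y <= 1.
Proof.
rewrite -(graph_sum1 x); apply: ler_sum => y _; rewrite mxE.
by case: (y != j); rewrite ?mulr1n // mulr0n graph_ge0.
Qed.

(** Both sides are the sum of the taboo series, and in particular the expected
    passage weights are finite. *)
Lemma mean_passageE (S : weighted_chain R n) :
    weighted_chain_on E P S -> weight_domain E (mean_weight S) ->
  mean_passage S = passage_formula P pi (mean_weight S).
Proof.
move=> chainS [eps eps_gt0 /Ubar_ge U_ge].
have irrP : irreducible P by case: graphEP.
apply/matrixP => i j; rewrite mxE (expected_passage_weight chainS).
set V := mean_weight S in U_ge *.
pose a m := (taboo P j ^+ m *m Ucol P V) i 0.
have U_ge' x : eps <= Ucol P V x 0 by rewrite mxE.
have sum_cvg : (fun N => \sum_(m < N) a m) @ \oo --> passage_formula P pi V i j.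
  have -> : passage_formula P pi V i j = col j (passage_formula P pi V) i 0.
    by rewrite [RHS]mxE.
  apply: (poisson_series_cvg (taboo_ge0 j) _ (taboo_sum_le1 j) eps_gt0 U_ge').
  by apply: passage_formula_poisson; [exact: graph_stationary_gt0 |
    exact: graph_ge0 | exact: graph_sum1 | exact: irrP | exact: statP].
rewrite (_ : (\sum_(m <oo) _)%E = (passage_formula P pi V i j)%:E) //.
apply: cvg_lim => //.
rewrite (_ : (fun N => _) = EFin \o (fun N => \sum_(m < N) a m)).
  by apply: (cvg_comp _ _ sum_cvg).
by apply/funext => N /=; rewrite big_mkord sumEFin.
Qed.

End MeanPassage.

(** * Differentiation along a line *)

Section LineDerivative.
Context (R : realType).

(** A directional derivative only involves the restriction to a line; this moves
    the problem to functions of a real variable. *)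
Lemma is_derive_line (V W : normedModType R) (f : V -> W) (a v : V) df :
  is_derive (0 : R) (1 : R) (fun h : R => f (h *: v + a)) df -> is_derive a v f df.
Proof.
have quotE : (fun h : R => h^-1 *: (f (h *: v + a) - f a)) =
    (fun h : R => h^-1 *: (f ((h *: (1 : R^o) + 0 : R^o) *: v + a)
                           - f ((0 : R) *: v + a))).
  by apply/funext => h; rewrite addr0 scale0r add0r [h *: 1]mulr1.
move=> [dv dE]; split; first by rewrite /derivable quotE.
by rewrite -dE /derive quotE.
Qed.

Lemma is_derive_affine (W : normedModType R) (a b : W) :
  is_derive (0 : R) (1 : R) (fun h : R => h *: b + a) b.
Proof.
have quot_cvg : (fun h : R => h^-1 *:
    (((h *: (1 : R^o) + 0 : R^o) *: b + a) - ((0 : R) *: b + a))) @ 0^' --> b.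
  apply: cvg_near_cst; near=> h.
  have h_neq0 : h != 0 by near: h; exact: nbhs_dnbhs_neq.
  by rewrite addr0 [h *: 1]mulr1 scale0r add0r addrK scalerA mulVf // scale1r.
split; first by apply/cvg_ex; exists b.
exact: cvg_lim quot_cvg.
Unshelve. all: by end_near. Qed.

Lemma is_derive_quotient (a b c Y : R) : Y != 0 ->
  is_derive (0 : R) (1 : R) (fun h : R => (h * b + a) / (h * c + Y))
    ((b * Y - a * c) / Y ^+ 2).
Proof.
move=> Y0.
have D : 0 * c + Y = Y by rewrite mul0r add0r.
have dnum := is_derive_affine (a : R^o) b.
have dden := is_derive_affine (Y : R^o) c.
have dinv := is_deriveV (f := fun h : R => h * c + Y) (x := 0) (v := 1).
have := is_deriveM dnum (dinv c _ dden).
rewrite D => /(_ Y0) dquot; apply: is_derive_eq.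
by rewrite scale0r add0r /GRing.scale /=; field.
Qed.

Lemma is_derive_quadratic_form n (p : 'I_n -> R -> R) (dp : 'I_n -> R)
    (m : 'I_n -> 'I_n -> R -> R) (dm : 'I_n -> 'I_n -> R) (x : R) :
    (forall i, is_derive x (1 : R) (p i) (dp i)) ->
    (forall i j, is_derive x (1 : R) (m i j) (dm i j)) ->
  is_derive x (1 : R) (fun h => \sum_i \sum_j p i h * m i j h * p j h)
    (\sum_i \sum_j (dp i * m i j x * p j x + p i x * dm i j * p j x
                    + p i x * m i j x * dp j)).
Proof.
move=> dpP dmP.
have -> : (fun h => \sum_i \sum_j p i h * m i j h * p j h) =
    \sum_(i < n) \sum_(j < n) (p i * m i j * p j).
  by apply/funext => h; rewrite fct_sumE; apply: eq_bigr => i _; rewrite fct_sumE.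
apply: is_derive_sum => i; apply: is_derive_sum => j.
apply: is_derive_eq.
by rewrite fctE /GRing.scale /=; ring.
Qed.

End LineDerivative.

(** * Perturbing the weight of one edge *)

Section EdgePerturbation.
Context (R : realType) (n : nat) (P : 'M[R]_n) (pi : 'rV[R]_n) (l k : 'I_n).

Lemma Ubar_delta i : Ubar P (delta_mx l k) i = P l k *+ (i == l).
Proof.
rewrite /Ubar (bigD1 k) //= big1 ?addr0 => [|j /negbTE jk]; last first.
  by rewrite mxE jk andbF mulr0.
by rewrite mxE eqxx andbT; case: eqP => [->|_]; rewrite ?mulr1 ?mulr0.
Qed.

Lemma Ytot_delta : Ytot pi P (delta_mx l k) = pi 0 l * P l k.
Proof.
rewrite /Ytot (bigD1 l) //= big1 ?addr0 => [|i /negbTE il].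
  by rewrite Ubar_delta eqxx.
by rewrite Ubar_delta il mulr0.
Qed.

Lemma passage_formula_delta :
  let Z := Zmx P pi in let el : 'cV[R]_n := unit_col l in
  let one : 'cV[R]_n := ones in
  passage_formula P pi (delta_mx l k) =
  P l k *: (Z *m el *m one^T - one *m one^T *m dg (Z *m el *m one^T)
       + pi 0 l *: ((1%:M - Z + one *m one^T *m dg Z) *m invmx (Xi pi))).
Proof.
move=> Z el one; rewrite /passage_formula Ytot_delta -/Z -/one.
have -> : Ucol P (delta_mx l k) = P l k *: el.
  apply/matrixP => i z; rewrite !mxE Ubar_delta ord1 eqxx andbT.
  by rewrite mulr_natr.
have dgZ (a : R) (A : 'M[R]_n) : dg (a *: A) = a *: dg A.
  by apply/matrixP => i j; rewrite !mxE; case: eqP; rewrite ?mulr0.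
rewrite -scalemxAr -scalemxAl dgZ -scalemxAr [pi 0 l * _]mulrC -scalerA.
by rewrite scalerDr scalerBr.
Qed.

Lemma mulmx_rowcolE (u : 'rV[R]_n) (A : 'M[R]_n) (v : 'cV[R]_n) :
  (u *m A *m v) 0 0 = \sum_i \sum_j u 0 i * A i j * v j 0.
Proof.
rewrite mxE exchange_big /=; apply: eq_bigr => j _.
by rewrite mxE mulr_suml.
Qed.

End EdgePerturbation.

(** Half of the lower bound of the weights survives a perturbation of one edge
    by less than that half. *)
Lemma weight_domain_line (R : realType) (n : nat) (E : rel 'I_n)
    (W : 'M[R]_n) l k :
  E l k -> weight_domain E W ->
  \forall h \near (0 : R), weight_domain E (h *: delta_mx l k + W).
Proof.
move=> Elk [eps eps_gt0 [W_ge W_0]].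
have eps2 : 0 < eps / 2 by rewrite divr_gt0.
near=> h; exists (eps / 2) => //.
have h_lt : `|h| < eps / 2.
  by near: h; apply: (@nbhs0_lt _ R).
split=> i j Eij; rewrite !mxE.
  have := W_ge i j Eij; have : - (eps / 2) <= h.
    by move: h_lt; rewrite ltr_norml => /andP[/ltW].
  by case: (_ && _); rewrite /= ?mulr1 ?mulr0; lra.
rewrite W_0 // addr0; case: andP => [[/eqP il /eqP jk]|_]; last by rewrite mulr0.
by move: Eij; rewrite il jk Elk.
Unshelve. all: by end_near. Qed.

(* [G] chooses, for every admissible mean weight matrix [V], a weighted
   Markovian graph on the fixed [E] and [P] with mean weights [V]: this is how
   [M] and [K] are regarded as functions of the mean weights. *)
Theorem theorem5 (R : realType) (n : nat) (E : rel 'I_n.+1)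
  (P : 'M[R]_n.+1) (pi : 'rV[R]_n.+1)
  (G : 'M[R]_n.+1 -> weighted_chain R n.+1)
  (graphEP : markovian_graph E P) (statP : unique_stationary P pi)
  (chainG : forall V, weight_domain E V ->
     weighted_chain_on E P (G V) /\ mean_weight (G V) = V)
  (W : 'M[R]_n.+1) (domW : weight_domain E W)
  (l k : 'I_n.+1) (Elk : E l k) :
  let M := fun V : 'M[R]_n.+1 => mean_passage (G V) in
  let K := fun V : 'M[R]_n.+1 => kemeny pi P (G V) in
  let Y := Ytot pi P W in
  let nv := nvec pi P W in
  let pw := piW pi P W in
  let Z := Zmx P pi in
  let el : 'cV[R]_n.+1 := unit_col l in
  let one : 'cV[R]_n.+1 := ones in
  is_derive W (delta_mx l k) K
    (pi 0 l * P l k / Y ^+ 2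
       * ((Y *: el - nv)^T *m M W *m pw^T + pw *m M W *m (Y *: el - nv)) 0 0
     + (pw *m 'D_(delta_mx l k) M W *m pw^T) 0 0)
  /\
  is_derive W (delta_mx l k) M
    (P l k *: (Z *m el *m one^T - one *m one^T *m dg (Z *m el *m one^T)
       + pi 0 l *: ((1%:M - Z + one *m one^T *m dg Z) *m invmx (Xi pi)))).
Proof.
move=> M K Y nv pw Z el one.
pose F := passage_formula P pi; pose D := F (delta_mx l k).
have [stat _] := statP.
have pi_gt0 := graph_stationary_gt0 graphEP stat.
have ME V : weight_domain E V -> M V = F V.
  move=> domV; have [chainV meanV] := chainG _ domV.
  by rewrite /M (mean_passageE graphEP stat) ?meanV.
have near_dom := weight_domain_line Elk domW.
have dM : is_derive W (delta_mx l k) M D.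
  apply: is_derive_line; apply: near_eq_is_derive (is_derive_affine (F W) D).
  near=> h; rewrite ME; last by near: h.
  by rewrite /F passage_formula_line.
rewrite -passage_formula_delta; split=> //.
have -> : 'D_(delta_mx l k) M W = D by case: dM.
have Y_gt0 : 0 < Y.
  case: domW => eps eps_gt0 /(Ubar_ge graphEP) U_ge.
  have U_gt0 i : 0 < Ubar P W i by exact: lt_le_trans (U_ge i).
  rewrite /Y /Ytot (bigD1 ord0) //= ltr_wpDr ?mulr_gt0 // sumr_ge0 // => i _.
  by rewrite ltW // mulr_gt0.
pose dl i := pi 0 i * Ubar P (delta_mx l k) i.
pose c := pi 0 l * P l k.
pose p i h := (h * dl i + pi 0 i * Ubar P W i) / (h * c + Y).
pose m i j h : R := h * D i j + F W i j.
apply: is_derive_line.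
apply: (near_eq_is_derive (f := fun h => \sum_i \sum_j p i h * m i j h * p j h)).
  near=> h.
  have domh : weight_domain E (h *: delta_mx l k + W) by near: h.
  have [_ meanh] := chainG _ domh.
  rewrite /K /kemeny meanh -/(M _) ME // /F passage_formula_line //.
  have piWE i : piW pi P (h *: delta_mx l k + W) 0 i = p i h.
    by rewrite mxE Ubar_line Ytot_line Ytot_delta mulrDr mulrCA.
  apply: eq_bigr => i _; apply: eq_bigr => j _.
  by rewrite !piWE [X in _ * X * _ = _]/m -[F _ i j]/(F W i j) [in RHS]mxE
    [X in _ = _ * (X + _) * _]mxE.
pose d : 'cV[R]_n.+1 := Y *: el - nv.
(* Quotient rule for the normalised weights: up to the factor [c / Y ^+ 2] their
   derivatives are the entries of [Y *: el - nv]. *)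
have dp i : is_derive (0 : R) (1 : R) (p i) (c / Y ^+ 2 * d i 0).
  apply: is_derive_eq (is_derive_quotient _ _ _ (lt0r_neq0 Y_gt0)) _.
  rewrite /dl Ubar_delta /d !mxE eqxx andbT.
  rewrite (_ : pi 0 i * (P l k *+ (i == l)) = c * (i == l)%:R); last first.
    by rewrite /c; case: eqP => [->|_]; rewrite ?mulr1 ?mulr0.
  by field; exact: lt0r_neq0.
have dm i j : is_derive (0 : R) (1 : R) (m i j) (D i j).
  exact: (is_derive_affine (F W i j : R^o) (D i j)).
apply: is_derive_eq (is_derive_quadratic_form dp dm) _.
have p0E i : p i 0 = pw 0 i by rewrite /p !mul0r !add0r mxE.
have m0E i j : m i j 0 = M W i j by rewrite /m mul0r add0r ME.
rewrite -/d -/c [X in _ * X + _]mxE !mulmx_rowcolE.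
rewrite mulrDr !mulr_sumr -!big_split /=.
apply: eq_bigr => i _; rewrite !mulr_sumr -!big_split /=.
apply: eq_bigr => j _; rewrite !p0E !m0E.
rewrite [d^T 0 i]mxE [pw^T j 0]mxE.
by ring.
Unshelve. all: by end_near. Qed.
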